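(* Let $k\ge 3$, $\omega=\cos(2\pi/k)+\mathbf{i}\sin(2\pi/k)$, and let $M_G$ be a connected mixed graph with underlying graph $G$ of maximum degree $\Delta(G)$. Then every eigenvalue $\lambda$ of $H(M_G)$ satisfies $|\lambda|\le\Delta(G)$. Moreover, $\rho(M_G)=\Delta(G)$ if and only if $G$ is $\Delta(G)$-regular and one can partition $V(M_G)$ into $k$ (possibly empty) parts $V_1,\dots,V_k$ such that one of the following holds: (i) every undirected edge $uv$ satisfies $u,v\in V_j$ for some $j$, and every arc from $u$ to $v$ satisfies $u\in V_r$, $v\in V_s$ with $r-s\equiv1\pmod k$; (ii) $k$ is even, each $V_j$ is an independent set in $M_G$, every undirected edge $uv$ satisfies $u\in V_j$, $v\in V_s$ with $s-j\equiv \frac k2\pmod k$, and every arc from $u$ to $v$ satisfies $u\in V_j$, $v\in V_r$ with $r-j\equiv \frac k2-1\pmod k$; (iii) $k$ is odd, and $V(M_G)$ can be partitioned into $2k$ (possibly empty) parts $V_1',\dots,V_k',V_1'',\dots,V_k''$ such that every undirected edge $uv$ satisfies $u\in V_j'$ and $v\in V_j''$ for some $j$, and every arc from $u$ to $v$ satisfies $u\in V_r'$, $v\in V_s''$ (or $u\in V_r''$, $v\in V_s'$) for some $r,s$ with $r-s\equiv 1\pmod k$.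
   Context: A mixed graph $M_G$ is obtained from a simple graph $G$ (its underlying graph) by leaving some edges undirected and replacing each other edge by an arc; it is connected if $G$ is, and the degree of a vertex is its degree in $G$. The Hermitian adjacency matrix $H(M_G)=(h_{uv})$ has $h_{uv}=\omega$ if there is an arc from $u$ to $v$, $h_{uv}=\overline{\omega}$ if there is an arc from $v$ to $u$, $h_{uv}=1$ if $uv$ is an undirected edge, and $0$ otherwise. The spectral radius is $\rho(M_G)=\max|\lambda|$ over the eigenvalues $\lambda$ of $H(M_G)$. *)

(* Defs.v *)
From mathcomp Require Import all_boot all_order all_algebra.
From mathcomp Require Import complex reals trigo.

Set Implicit Arguments.
Unset Strict Implicit.
Unset Printing Implicit Defensive.

Import Order.TTheory GRing.Theory Num.Theory.
Local Open Scope ring_scope.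

Record simple_graph (T : finType) := SimpleGraph {
  adj : rel T;
  adj_sym : symmetric adj;
  adj_irr : irreflexive adj }.

Definition connected_graph (T : finType) (G : simple_graph T) : Prop :=
  (0 < #|T|)%N /\ forall u v : T, connect (adj G) u v.

Definition degree (T : finType) (G : simple_graph T) (u : T) : nat :=
  #|[set v | adj G u v]|.

Definition max_degree (T : finType) (G : simple_graph T) : nat :=
  \max_(u : T) degree G u.

Definition regular_graph (T : finType) (G : simple_graph T) (d : nat) : Prop :=
  forall u : T, degree G u = d.

Definition independent_set (T : finType) (G : simple_graph T) (A : {set T}) : Prop :=
  {in A &, forall u v, ~~ adj G u v}.

(* A mixed graph with underlying graph G is determined by its arcs: each edge
   of G carries at most one arc, and the edges carrying none are undirected. *)
Record mixed_graph (T : finType) (G : simple_graph T) := MixedGraph {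
  has_arc : rel T;
  has_arc_adj : forall u v, has_arc u v -> adj G u v;
  has_arc_asym : forall u v, has_arc u v -> ~~ has_arc v u }.

Definition undirected (T : finType) (G : simple_graph T) (M : mixed_graph G) :
    rel T :=
  fun u v => [&& adj G u v, ~~ has_arc M u v & ~~ has_arc M v u].

Definition eigenvalues (R : realType) (n : nat) (A : 'M[R[i]]_n) : seq R[i] :=
  sval (closed_field_poly_normal (char_poly A)).

Lemma mem_eigenvalues (R : realType) (n : nat) (A : 'M[R[i]]_n) (a : R[i]) :
  (a \in eigenvalues A) = eigenvalue A a.
Proof.
rewrite eigenvalue_root_char /eigenvalues.
case: closed_field_poly_normal => s /= ps.
by rewrite [in RHS]ps (monicP (char_poly_monic A)) scale1r root_prod_XsubC.
Qed.

(* The norm on R[i] takes its (real) values in R[i], hence the real part. *)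
Definition spectral_radius (R : realType) (n : nat) (A : 'M[R[i]]_n) : R :=
  \big[Num.max/0]_(a <- eigenvalues A) complex.Re `|a|.

Definition omega (R : realType) (k : nat) : R[i] :=
  Complex (cos (2 * pi / k%:R)) (sin (2 * pi / k%:R)).

Definition hermitian_entry (R : realType) (k : nat) (T : finType)
    (G : simple_graph T) (M : mixed_graph G) (u v : T) : R[i] :=
  if has_arc M u v then omega R k
  else if has_arc M v u then (omega R k)^*
  else if undirected M u v then 1
  else 0.

Definition hermitian_adj (R : realType) (k : nat) (T : finType)
    (G : simple_graph T) (M : mixed_graph G) : 'M[R[i]]_#|T| :=
  \matrix_(i, j) hermitian_entry R k M (enum_val i) (enum_val j).

(* Unlike finset's partition, this allows empty parts. *)
Definition partition_into (T I : finType) (V : I -> {set T}) : Prop :=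
  \bigcup_(i : I) V i = [set: T] /\
  forall i j : I, i != j -> [disjoint V i & V j].

(* In the three conditions below the indices 1, ..., k are replaced by
   0, ..., k - 1; they only matter modulo k. *)
Definition cond_i (k : nat) (T : finType) (G : simple_graph T)
    (M : mixed_graph G) (V : 'I_k -> {set T}) : Prop :=
  (forall u v, undirected M u v -> exists j : 'I_k, u \in V j /\ v \in V j) /\
  (forall u v, has_arc M u v -> exists r s : 'I_k,
     [/\ u \in V r, v \in V s & (r%:Z - s%:Z = 1 %[mod k%:Z])%Z]).

Definition cond_ii (k : nat) (T : finType) (G : simple_graph T)
    (M : mixed_graph G) (V : 'I_k -> {set T}) : Prop :=
  [/\ ~~ odd k,
      forall j : 'I_k, independent_set G (V j),
      forall u v, undirected M u v -> exists j s : 'I_k,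
        [/\ u \in V j, v \in V s & (s%:Z - j%:Z = k./2%:Z %[mod k%:Z])%Z]
    & forall u v, has_arc M u v -> exists j r : 'I_k,
        [/\ u \in V j, v \in V r & (r%:Z - j%:Z = k./2%:Z - 1 %[mod k%:Z])%Z]].

(* V' and V'' are the two halves of the partition into 2k parts. As uv is an
   unordered pair for an undirected edge, either end may lie in V' j. *)
Definition cond_iii (k : nat) (T : finType) (G : simple_graph T)
    (M : mixed_graph G) : Prop :=
  odd k /\
  exists V' V'' : 'I_k -> {set T},
    [/\ partition_into
          (fun x : 'I_k + 'I_k => match x with inl j => V' j | inr j => V'' j end),
        forall u v, undirected M u v -> exists j : 'I_k,
          (u \in V' j /\ v \in V'' j) \/ (v \in V' j /\ u \in V'' j)
      & forall u v, has_arc M u v -> exists r s : 'I_k,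
          ((u \in V' r /\ v \in V'' s) \/ (u \in V'' r /\ v \in V' s)) /\
          (r%:Z - s%:Z = 1 %[mod k%:Z])%Z].

(* Main.v *)
Require Import Defs.
From mathcomp Require Import all_boot all_order all_algebra.
From mathcomp Require Import complex reals trigo ring.
Set Implicit Arguments.
Unset Strict Implicit.
Unset Printing Implicit Defensive.
Import Order.TTheory GRing.Theory Num.Theory.
Local Open Scope ring_scope.

(** Let x be an eigenvector for a with |a| = Delta > 0. At a vertex v where |x|
    is maximal, a x_v is the sum of the x_u h_uv over the neighbours u, so
    equality in the triangle inequality forces deg v = Delta, |x_u| = |x_v| and
    x_u h_uv = eps x_v with eps = a / Delta. By connectedness this holds at every
    vertex, and using an edge in both directions gives eps = 1 or -1. After
    scaling x to 1 at one vertex, all its values are signed powers of omega, and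
    the parts V_j are the sets where x = omega^(-j) (when eps = -1 and k is odd,
    the V'_j and V''_j are the sets where x = omega^(-j) and x = -omega^(-j)).
    Conversely, the labels of such a partition form an eigenvector of a regular
    graph for the eigenvalue Delta or -Delta. *)

(** * Powers of the primitive [k]-th root of unity [omega R k] *)

Section Omega.
Variables (R : realType) (k : nat).
Hypothesis k_gt0 : (0 < k)%N.
Local Notation w := (omega R k).

Lemma expr_cos_sin (t : R) n :
  (Complex (cos t) (sin t)) ^+ n = Complex (cos (t *+ n)) (sin (t *+ n)).
Proof.
elim: n => [|n IHn]; first by rewrite expr0 mulr0n cos0 sin0.
rewrite exprS IHn mulrS cosD sinD; apply/eqP; rewrite eq_complex /= eqxx /=.
by rewrite addrC.
Qed.

(** For [0 < n < k] the angle of [w ^+ n] is twice some [t] strictly between 0 and [pi], and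
    [cos (t *+ 2) = 1] would force [sin t = 0]. *)
Lemma omega_primitive : k.-primitive_root w.
Proof.
have k0 : (k%:R : R) != 0 by rewrite pnatr_eq0 -lt0n.
rewrite /primitive_root_of_unity k_gt0; apply/forallP => i; apply/eqP.
rewrite unity_rootE /omega expr_cos_sin.
set t := (_ *+ _); have -> : t = (pi * (i.+1%:R / k%:R)) *+ 2.
  by rewrite /t -[LHS]mulr_natr -[RHS]mulr_natl !mulrA mulrAC.
rewrite cos_mulr2n sin_mulr2n.
have [->|ne_ik] := eqVneq i.+1 k.
  by rewrite divff // mulr1 cospi sinpi mulr0 mul0rn sqrrN expr1n
             mulr2n addrK; apply/eqP.
have lt_ik : (i.+1 < k)%N by rewrite ltn_neqAle ne_ik ltn_ord.
apply/negbTE/eqP => -[+ _].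
have : 0 < sin (pi * (i.+1%:R / k%:R)) :> R.
  apply: sin_gt0_pi; rewrite mulr_gt0 ?pi_gt0 ?divr_gt0 ?ltr0n //=.
  by rewrite gtr_pMr ?pi_gt0 // ltr_pdivrMr ?ltr0n // mul1r ltr_nat.
move=> /gt_eqF; rewrite -sqrf_eq0 sin2cos2 => sin_neq0 /(canRL (subrK _)).
rewrite -mulr2n => /(pmulrnI (ltn0Sn 1)) cos_eq1.
by rewrite cos_eq1 subrr eqxx in sin_neq0.
Qed.

Lemma omega_neq0 : w != 0.
Proof.
apply/eqP => w0; have := prim_expr_order omega_primitive.
by rewrite w0 expr0n gtn_eqF // => /eqP; rewrite eq_sym oner_eq0.
Qed.

Lemma norm_omega : `|w| = 1.
Proof. by rewrite normc_def /= cos2Dsin2 sqrtr1. Qed.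

Lemma conj_omega : w^* = w^-1.
Proof.
apply: (mulfI omega_neq0); rewrite -normCK norm_omega expr1n divff //.
exact: omega_neq0.
Qed.

Lemma eq_omega_exprz (m n : int) :
  (w ^ m == w ^ n) = (m == n %[mod k%:Z])%Z.
Proof.
have w0 := omega_neq0.
rewrite eqz_mod_dvd -[m in LHS](subrK n) expfzDr //.
rewrite -{2}[w ^ n]mul1r (inj_eq (mulIf _)) ?expfz_neq0 //.
rewrite dvdzE (prim_order_dvd omega_primitive).
by case: (m - n) => d //; rewrite NegzE abszN -invr_expz invr_eq1.
Qed.

Lemma omega_expz_ord (m : int) : exists j : 'I_k, w ^ (- m) = w ^ (- j%:Z).
Proof.
have k0 : k%:Z != 0 by rewrite -lt0n.
have lt_mk : (`|(m %% k)%Z| < k)%N.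
  by rewrite -ltz_nat gez0_abs ?modz_ge0 // ltz_pmod.
exists (Ordinal lt_mk); apply/eqP; rewrite eq_omega_exprz /= gez0_abs ?modz_ge0 //.
by rewrite eqz_mod_dvd opprK addrC -eqz_mod_dvd modz_mod.
Qed.

(** With [w ^ (- a)] read as the label of part [a], this turns the index congruences of the three
    conditions into equations between labels. *)
Lemma omega_exprz_subE (a b c : int) :
  (a - b = c %[mod k%:Z])%Z <-> w ^ (- b) = w ^ c * w ^ (- a).
Proof.
rewrite -expfzDr ?omega_neq0 //; apply: (iff_trans (rwP eqP)).
rewrite (rwP (w ^ (- b) =P w ^ (c - a))) eq_omega_exprz !eqz_mod_dvd.
by rewrite (_ : - b - _ = a - b - c) //; ring.
Qed.

Lemma omega_exprz_order (m : int) : (w ^ m) ^+ k = 1.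
Proof.
by rewrite exprnP exprzAC -exprnP (prim_expr_order omega_primitive) exp1rz.
Qed.

(** The square is 1, and the value 1 itself would make [k] divide [k./2], which lies strictly
    between 0 and [k]. *)
Lemma omega_exprz_half : ~~ odd k -> w ^ k./2%:Z = -1.
Proof.
move=> k_even; have /eqP : (w ^+ k./2) ^+ 2 = 1.
  by rewrite -exprM muln2 even_halfK // (prim_expr_order omega_primitive).
rewrite sqrf_eq1 -(prim_order_dvd omega_primitive) => /orP[|/eqP//].
have half_lt : (k./2 < k)%N by rewrite ltn_half_double -addnn -[ltnLHS]addn0 ltn_add2l.
move/dvdn_leq; rewrite [(k <= _)%N]leqNgt half_lt half_gt0 => le_k.
by case: k k_gt0 k_even le_k => [|[|n]] //= _ _ /(_ isT).
Qed.

(** Raised to the odd power [k], the two sides become 1 and -1. *)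
Lemma omega_exprz_neqN (m n : int) : odd k -> w ^ m != - w ^ n.
Proof.
move=> k_odd; apply/eqP => /(congr1 (fun z => z ^+ k)).
rewrite exprNn -signr_odd k_odd !omega_exprz_order mulr1 => /eqP.
by rewrite -subr_eq0 opprK -mulr2n pnatr_eq0.
Qed.

Lemma omega_exprzN_inj : injective (fun j : 'I_k => w ^ (- j%:Z)).
Proof.
move=> i j; rewrite -!invr_expz => /invr_inj/eqP.
by rewrite (eq_prim_root_expr omega_primitive) !modn_small // => /eqP/val_inj.
Qed.

End Omega.

(** * Partitions with possibly empty parts as fibres of labellings *)

Section Labellings.
Variables (T I : finType) (A : choiceType).

Lemma partition_into_fibers (x : T -> A) (f : I -> A) :
    injective f -> (forall u, exists i, x u = f i) ->
  partition_into (fun i => [set u | x u == f i]).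
Proof.
move=> f_inj xf; split=> [|i j neq_ij].
  apply/setP=> u; rewrite inE; have [i xu] := xf u.
  by apply/bigcupP; exists i; rewrite // inE xu.
rewrite -setI_eq0; apply/eqP/setP=> u; rewrite !inE.
by apply/andP=> -[/eqP-> /eqP/f_inj/eqP]; apply/negP.
Qed.

Lemma partition_into_cover (V : I -> {set T}) u :
  partition_into V -> exists i, u \in V i.
Proof.
by case=> /setP/(_ u) + _; rewrite inE => /bigcupP[i _ uVi]; exists i.
Qed.

Lemma partition_into_labelling (V : I -> {set T}) (f : I -> A) :
  partition_into V -> exists x : T -> A, forall i u, u \in V i -> x u = f i.
Proof.
(* A vertex is needed to obtain a default index [i0]; over an empty [T] the labelling is vacuous. *)
move=> pV; have [/set0Pn[u0 _] | /negPn/eqP T0] := boolP ([set: T] != set0).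
  have [i0 _] := partition_into_cover u0 pV.
  exists (fun u => f (odflt i0 [pick i | u \in V i])) => i u uVi.
  case: pickP => [j uVj | /(_ i)]; last by rewrite uVi.
  congr f; apply/eqP/negPn/negP => /(proj2 pV).
  by rewrite -setI_eq0 => /eqP/setP/(_ u); rewrite !inE uVi uVj.
have noT (u : T) : False by have := in_setT u; rewrite T0 inE.
by exists (fun u => False_rect _ (noT u)) => i u; case: (noT u).
Qed.

End Labellings.

(** * Entries of [H] along edges, and eigenvectors as functions on the vertices *)

Section Spectrum.
Variables (R : realType) (k : nat) (T : finType) (G : simple_graph T).
Variable M : mixed_graph G.
Hypothesis k_gt0 : (0 < k)%N.
Local Notation C := R[i].
Local Notation w := (omega R k).
Local Notation h := (hermitian_entry R k M).
Local Notation H := (hermitian_adj R k M).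
Local Notation Delta := (max_degree G).

(** Indexed by both entries of an edge, so that one case analysis rewrites [h u v] and [h v u]
    together. *)
Variant edge_spec (u v : T) : C -> C -> Prop :=
  | EdgeOut of has_arc M u v : edge_spec u v w w^-1
  | EdgeIn of has_arc M v u : edge_spec u v w^-1 w
  | EdgeUndirected of undirected M u v & undirected M v u : edge_spec u v 1 1.

Lemma edgeP u v : adj G u v -> edge_spec u v (h u v) (h v u).
Proof.
move=> uv; rewrite /hermitian_entry.
case: ifPn => [Auv|nAuv].
  by rewrite (negPf (has_arc_asym Auv)) conj_omega //; constructor.
case: ifPn => [Avu|nAvu]; first by rewrite conj_omega //; constructor.
have Uuv : undirected M u v by rewrite /undirected uv nAuv nAvu.
have Uvu : undirected M v u by rewrite /undirected adj_sym uv nAuv nAvu.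
by rewrite Uuv Uvu; constructor.
Qed.

Lemma hermitian_entry_nonadj u v : ~~ adj G u v -> h u v = 0.
Proof.
move=> nuv; rewrite /hermitian_entry /undirected (negPf nuv) /=.
rewrite (contraNF (@has_arc_adj _ _ M u v)) // (contraNF (@has_arc_adj _ _ M v u)) //.
by rewrite adj_sym.
Qed.

Lemma norm_hermitian_entry u v : adj G u v -> `|h u v| = 1.
Proof. by case/edgeP=> *; rewrite ?normrV ?unitfE ?omega_neq0 ?norm_omega ?invr1 ?normr1. Qed.

Lemma hermitian_entryV u v : adj G u v -> h v u = (h u v)^-1.
Proof. by case/edgeP=> *; rewrite ?invrK ?invr1. Qed.

(** Eigenvectors are row vectors, so [x] multiplies [H] from the left; entries off the edges vanish,
    which leaves the neighbours of [v]. *)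
Lemma eigenvalue_hermitianP (a : C) :
  eigenvalue H a <->
  exists2 x : T -> C, exists v, x v != 0 &
    forall v, \sum_(u | adj G u v) x u * h u v = a * x v.
Proof.
have sumE (x : T -> C) v :
    \sum_(u | adj G u v) x u * h u v =
    \sum_(i < #|T|) x (enum_val i) * h (enum_val i) v.
  rewrite -(big_enum_val (A := T) (fun u => x u * h u v)) big_mkcond /=.
  apply: eq_bigr => u _; case: ifPn => // /hermitian_entry_nonadj->.
  by rewrite mulr0.
split=> [/eigenvalueP[y yH y0] | [x [v0 xv0] xH]].
  exists (fun u => y 0 (enum_rank u)).
    have [j yj] : exists j, y 0 j != 0 by apply/rV0Pn.
    by exists (enum_val j); rewrite enum_valK.
  move=> v; have /rowP/(_ (enum_rank v)) := yH; rewrite !mxE sumE => <-.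
  by apply: eq_bigr => i _; rewrite !mxE !enum_valK enum_rankK.
apply/eigenvalueP; exists (\row_j x (enum_val j)).
  apply/rowP=> j; rewrite !mxE -xH sumE.
  by apply: eq_bigr => i _; rewrite !mxE.
by apply/rV0Pn; exists (enum_rank v0); rewrite mxE enum_rankK.
Qed.

(** * The bound by the maximum degree and its equality case *)

Lemma sum_adj_const (c : C) v : \sum_(u | adj G u v) c = (degree G v)%:R * c.
Proof.
rewrite sumr_const /degree cardsE mulr_natl; congr (_ *+ _).
by apply: eq_card => u; rewrite !unfold_in /= adj_sym.
Qed.

Lemma degree_le_max v : (degree G v <= Delta)%N.
Proof. exact: (leq_bigmax v). Qed.

(** The eigenvector equation split edge by edge: all summands at [v] agree. *)
Definition potential (eps : C) (x : T -> C) :=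
  forall u v, adj G u v -> x u * h u v = eps * x v.

(** The triangle inequality at a vertex of maximal modulus. Working at a single vertex allows
    [eigenvalue_potential] to pass to a neighbour and apply it again there. *)
Lemma eigenvector_local (a : C) (x : T -> C) v :
    x v != 0 -> (forall u, `|x u| <= `|x v|) ->
    \sum_(u | adj G u v) x u * h u v = a * x v ->
  `|a| <= (degree G v)%:R /\
  (`|a| = Delta%:R -> (0 < Delta)%N ->
   degree G v = Delta /\
   forall u, adj G u v -> x u * h u v = a / Delta%:R * x v).
Proof.
move=> xv0 xmax xH; have xv_gt0 : 0 < `|x v| by rewrite normr_gt0.
have term_le u : adj G u v -> `|x u * h u v| <= `|x v|.
  by move=> uv; rewrite normrM norm_hermitian_entry ?mulr1.
have le_deg : `|a| <= (degree G v)%:R.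
  rewrite -(ler_pM2r xv_gt0) -normrM -xH -sum_adj_const.
  by apply: le_trans (ler_norm_sum _ _ _) _; apply: ler_sum.
split=> // aD D_gt0; have degD : degree G v = Delta.
  by apply/eqP; rewrite eqn_leq degree_le_max -(ler_nat C) -aD.
split=> // u uv.
have D0 : Delta%:R != 0 :> C by rewrite pnatr_eq0 -lt0n.
have a0 : a != 0 by rewrite -normr_eq0 aD.
(* The unit [c] rotates the expected common value of the summands onto the positive reals; the sum
   then attains the sum of the bounds, so each summand equals its bound. *)
pose c := `|x v| / (a / Delta%:R * x v).
have nc : `|c| = 1.
  by rewrite /c !normrM normfV !normrM normfV normr_id aD normr_nat divff // mul1r
             divff ?normr_eq0.
have c0 : c != 0 by rewrite -normr_eq0 nc oner_eq0.
have Fle i : adj G i v -> `|x i * h i v * c| <= `|x v|.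
  by move=> iv; rewrite normrM nc mulr1 term_le.
have Fsum : \sum_(i | adj G i v) x i * h i v * c = \sum_(i | adj G i v) `|x v|.
  rewrite -mulr_suml xH sum_adj_const degD /c.
  by field; rewrite xv0 a0 D0.
have /= e := normC_sum_upper Fle Fsum uv.
apply: (mulIf c0); rewrite e /c mulrC divfK //.
by rewrite !mulf_neq0 ?invr_eq0.
Qed.

(** The order on [R[i]] is partial, so the maximum is taken over the real parts of the norms. *)
Lemma exists_max_norm (x : T -> C) (v0 : T) :
  exists v, forall u, `|x u| <= `|x v|.
Proof.
have normE (z : C) : `|z| = (complex.Re `|z|)%:C%C :> C by rewrite normc_def.
have [v _ vmax] := Order.TotalTheory.arg_maxP (fun u => complex.Re `|x u|) (erefl (predT v0)).
by exists v => u; rewrite normE [leRHS]normE lecR; apply: vmax.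
Qed.

Lemma eigenvalue_le_max_degree (a : C) : eigenvalue H a -> `|a| <= Delta%:R.
Proof.
case/eigenvalue_hermitianP=> x [v0 xv0] xH; have [v vmax] := exists_max_norm x v0.
have xv : x v != 0.
  by rewrite -normr_gt0 (lt_le_trans _ (vmax v0)) // normr_gt0.
have [le_a _] := eigenvector_local xv vmax (xH v).
by apply: le_trans le_a _; rewrite ler_nat degree_le_max.
Qed.

(** The maximum starts from the default 0, which by itself yields no eigenvalue; hence the separate
    case [Delta = 0]. A positive maximum is the value at a member of the list. *)
Lemma spectral_radius_hermitianP :
  spectral_radius H = Delta%:R <->
  Delta = 0%N \/ exists2 a, eigenvalue H a & `|a| = Delta%:R.
Proof.
have normE (z : C) : `|z| = (complex.Re `|z|)%:C%C :> C by rewrite normc_def.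
have natE n : n%:R = (n%:R : R)%:C%C :> C by rewrite rmorph_nat.
have rho_le : spectral_radius H <= Delta%:R.
  rewrite /spectral_radius big_seq_cond; apply: bigmax_le => // a.
  rewrite andbT mem_eigenvalues => /eigenvalue_le_max_degree.
  by rewrite normE natE lecR.
split=> [rhoD | [D0 | [a aH aD]]].
- have [-> | D_gt0] := posnP Delta; [by left | right].
  have : forall s : seq C, (forall a, a \in s -> eigenvalue H a) ->
      \big[Num.max/0]_(a <- s) complex.Re `|a| = Delta%:R ->
      exists2 a, eigenvalue H a & `|a| = Delta%:R.
    elim=> [_|a s IHs sH]; rewrite ?big_nil ?big_cons.
      by move/esym/eqP; rewrite pnatr_eq0 gtn_eqF.
    case: leP => _ eD; first by apply: IHs eD => b bs; rewrite sH ?inE ?bs ?orbT.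
    by exists a; rewrite ?sH ?mem_head // normE eD natE.
  by apply; last exact: rhoD; move=> a; rewrite mem_eigenvalues.
- by apply/le_anti; rewrite rho_le D0 /spectral_radius bigmax_ge_id.
apply/le_anti; rewrite rho_le /=; apply: (@bigmax_sup_seq _ _ _ _ _ a) => //.
  by rewrite mem_eigenvalues.
by rewrite -lecR -normE aD natE.
Qed.

Lemma regular_potential_eigenvalue (eps : C) (x : T -> C) v0 :
    regular_graph G Delta -> x v0 != 0 -> potential eps x ->
  eigenvalue H (Delta%:R * eps).
Proof.
move=> reg xv0 pot; apply/eigenvalue_hermitianP; exists x; first by exists v0.
move=> v; rewrite (eq_bigr (fun=> eps * x v)); last by move=> u; apply: pot.
by rewrite sum_adj_const reg mulrA.
Qed.

Lemma connect_ind (P : T -> Prop) v0 :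
    connected_graph G -> P v0 -> (forall u v, adj G u v -> P v -> P u) ->
  forall u, P u.
Proof.
move=> [_ conn] P0 step u; have /connectP[p] := conn u v0.
elim: p u => [|u' p IHp] u /=; first by move=> _ <-.
by case/andP=> uu' /IHp/[apply] /(step u u' uu').
Qed.

Lemma eigenvalue_potential (a : C) : connected_graph G ->
    (0 < Delta)%N -> eigenvalue H a -> `|a| = Delta%:R ->
  regular_graph G Delta /\
  exists (eps : C) (x : T -> C),
    [/\ eps ^+ 2 = 1, forall v, x v != 0 & potential eps x].
Proof.
move=> conn D_gt0 /eigenvalue_hermitianP[x [v0 xv0] xH] aD.
have [v vmax] := exists_max_norm x v0.
have xv : x v != 0.
  by rewrite -normr_gt0 (lt_le_trans _ (vmax v0)) // normr_gt0.
(* The local equality makes the modulus maximal at every neighbour too, hence everywhere by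
   connectedness. *)
have xall : forall u, `|x u| = `|x v|.
  apply: (connect_ind (v0 := v)) => // u u' uu' xu'.
  have xu'0 : x u' != 0 by rewrite -normr_eq0 xu' normr_eq0.
  have u'max w : `|x w| <= `|x u'| by rewrite xu'.
  have [_ /(_ aD D_gt0)[_ /(_ u uu')]] := eigenvector_local xu'0 u'max (xH u').
  move/(congr1 Num.norm); rewrite !normrM norm_hermitian_entry // mulr1 normfV aD.
  by rewrite normr_nat divff ?mul1r ?xu' // pnatr_eq0 -lt0n.
have x0 u : x u != 0 by rewrite -normr_eq0 xall normr_eq0.
have loc u : degree G u = Delta /\
    forall u', adj G u' u -> x u' * h u' u = a / Delta%:R * x u.
  have umax u' : `|x u'| <= `|x u| by rewrite !xall.
  by have [_] := eigenvector_local (x0 u) umax (xH u); apply.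
have pot : potential (a / Delta%:R) x by move=> u v' uv; apply: (loc v').2.
split; first by move=> u; apply: (loc u).1.
move: {loc} (a / Delta%:R) pot (loc v).1 => eps pot degv.
exists eps, x; split=> //.
(* Since [Delta > 0], [v] has a neighbour [u]; going along this edge and back multiplies by
   [h v u * h u v = 1], whence [eps ^+ 2 = 1]. *)
have /set0Pn[u] : [set u | adj G v u] != set0.
  by rewrite -card_gt0 -/(degree G v) degv.
rewrite inE => vu; have h0 : h v u != 0.
  by rewrite -normr_eq0 norm_hermitian_entry ?oner_eq0.
apply: (mulIf (x0 v)); rewrite expr2 -mulrA mul1r -(pot u v) 1?adj_sym //.
by rewrite mulrA -(pot v u) // (hermitian_entryV vu) mulfK.
Qed.

(** * From potentials to partitions and back *)

Lemma potentialP (eps : C) (x : T -> C) : eps ^+ 2 = 1 ->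
  potential eps x <->
  (forall u v, undirected M u v -> x u = eps * x v) /\
  (forall u v, has_arc M u v -> x u * w = eps * x v).
Proof.
move=> eps2; split=> [pot | [potU potA] u v uv].
  split=> u v; last first.
    by move=> Auv; rewrite -(pot u v) ?(has_arc_adj Auv) // /hermitian_entry Auv.
  move=> Uuv; case/and3P: (Uuv) => uv /negPf nAuv /negPf nAvu.
  by rewrite -(pot u v) // /hermitian_entry Uuv nAuv nAvu mulr1.
case: (edgeP uv) => [|Avu|Uuv _]; rewrite ?mulr1; [exact: potA | | exact: potU].
(* Against the direction of an arc, the equation is that of the arc multiplied by [eps], as
   [eps ^+ 2 = 1]. *)
apply: (canLR (mulfK (omega_neq0 R k_gt0))).
by rewrite -mulrA (potA v u) // mulrA -expr2 eps2 mul1r.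
Qed.

Lemma potential_scale (eps c : C) (x : T -> C) :
  potential eps x -> potential eps (fun u => x u * c).
Proof. by move=> pot u v uv; rewrite mulrAC (pot u v) // mulrA. Qed.

(** Each edge multiplies the value by [eps] and by 1, [w] or [w^-1]; these factors accumulate along
    a path from [v0]. *)
Lemma potential_values (eps : C) (x : T -> C) v0 : connected_graph G ->
    eps ^+ 2 = 1 -> x v0 = 1 -> potential eps x ->
  forall u, exists (n : nat) (m : int), x u = eps ^+ n * w ^ (- m).
Proof.
move=> conn eps2 x0 pot; have w0 := omega_neq0 R k_gt0.
apply: (connect_ind (v0 := v0)) => //; first by exists 0%N, 0; rewrite mulr1.
move=> u v uv [n [m xv]]; exists n.+1.
suff [d hd] : exists d : int, h v u = w ^ (- d).
  exists (m + d); rewrite opprD expfzDr // mulrA exprS -mulrA -hd -mulrA.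
  have := pot v u; rewrite adj_sym => /(_ uv); rewrite xv -[_ * h v u]mulrA => ->.
  by rewrite mulrA -expr2 eps2 mul1r.
by case: (edgeP uv) => *; [exists 1|exists (-1)|exists 0]; rewrite ?opprK.
Qed.

(** Condition (i) gives [eps = 1], the others [eps = -1]. In (ii) the sign is the power [w ^ k./2];
    in (iii) no power of [w] is -1, and the choice between [V'] and [V''] records the sign. *)
Lemma partition_potential (V : 'I_k -> {set T}) : partition_into V ->
    [\/ cond_i M V, cond_ii M V | cond_iii k M] ->
  exists (eps : C) (x : T -> C),
    [/\ eps ^+ 2 = 1, forall v, x v != 0 & potential eps x].
Proof.
move=> pV; have w0 := omega_neq0 R k_gt0.
have eps2 : (-1) ^+ 2 = 1 :> C by rewrite sqrrN expr1n.
have [x xV] := partition_into_labelling (fun j : 'I_k => w ^ (- j%:Z)) pV.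
have x0 v : x v != 0.
  by have [i /xV->] := partition_into_cover v pV; rewrite expfz_neq0.
case=> [[undV arcV] | [k_even _ undV arcV] | [k_odd [V' [V'' [pV' undV arcV]]]]].
- exists 1, x; rewrite expr1n; split=> //; apply/potentialP; rewrite ?expr1n //.
  split=> u v; first by case/undV=> j [/xV-> /xV->]; rewrite mul1r.
  case/arcV=> r [s [/xV-> /xV-> /(omega_exprz_subE R k_gt0)->]].
  by rewrite mul1r mulrC.
- exists (-1), x; split=> //; apply/potentialP => //.
  split=> u v.
    case/undV=> j [s [/xV-> /xV-> /(omega_exprz_subE R k_gt0)->]].
    by rewrite omega_exprz_half.
  case/arcV=> j [r [/xV-> /xV-> /(omega_exprz_subE R k_gt0)->]].
  by rewrite mulrAC expfzDr // omega_exprz_half // divfK.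
pose f (i : 'I_k + 'I_k) : C :=
  match i with inl j => w ^ (- j%:Z) | inr j => - w ^ (- j%:Z) end.
have [y yV] := partition_into_labelling f pV'.
have yl j u : u \in V' j -> y u = w ^ (- j%:Z) by apply: (yV (inl j)).
have yr j u : u \in V'' j -> y u = - w ^ (- j%:Z) by apply: (yV (inr j)).
exists (-1), y; split=> //.
  move=> v; have [i /yV->] := partition_into_cover v pV'.
  by case: i => j; rewrite /= ?oppr_eq0 expfz_neq0.
apply/potentialP => //; split=> u v.
  by case/undV=> j [] [/yl-> /yr->]; rewrite mulN1r ?opprK.
case/arcV=> r [s [uv /(omega_exprz_subE R k_gt0) rs]].
case: uv => [] [].
  by move=> /yl-> /yr->; rewrite rs mulN1r opprK mulrC.
by move=> /yr-> /yl->; rewrite rs mulN1r mulNr mulrC.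
Qed.

Lemma potential_partition (eps : C) (x : T -> C) :
    (3 <= k)%N -> connected_graph G ->
    eps ^+ 2 = 1 -> (forall v, x v != 0) -> potential eps x ->
  exists V : 'I_k -> {set T},
    partition_into V /\ [\/ cond_i M V, cond_ii M V | cond_iii k M].
Proof.
move=> k_ge3 conn eps2 x_neq0; have w0 := omega_neq0 R k_gt0.
have /card_gt0P[v0 _] := conn.1.
(* Scaling sets the value at [v0] to 1, as [potential_values] requires. *)
move/(potential_scale (x v0)^-1); set y := fun u => _ => pot.
have val := potential_values conn eps2 (divff (x_neq0 v0) : y v0 = 1) pot.
have [potU potA] := (potentialP y eps2).1 pot.
move: (y : T -> C) potU potA val {pot} => {}y potU potA val.
pose f (j : 'I_k) : C := w ^ (- j%:Z).
have f_inj : injective f := @omega_exprzN_inj R k k_gt0.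
pose V (j : 'I_k) := [set u | y u == f j].
have pV : (forall u, exists m : int, y u = w ^ (- m)) -> partition_into V.
  move=> yw; apply: partition_into_fibers => // u; have [m ->] := yw u.
  exact: omega_expz_ord.
have VE u j : u \in V j -> y u = f j by rewrite inE => /eqP.
have Vex u : partition_into V -> exists2 j, u \in V j & y u = f j.
  by move=> pW; have [j uVj] := partition_into_cover u pW; exists j => //; apply: VE.
move: (eps2) => /eqP; rewrite sqrf_eq1 => /orP[]/eqP eps1; subst eps.
  have {}pV : partition_into V.
    by apply: pV => u; have [n [m ->]] := val u; exists m; rewrite expr1n mul1r.
  exists V; split=> //; apply: Or31; split=> u v.
    move=> /potU; rewrite mul1r => yuv.
    have [j uj _] := Vex u pV; exists j; split=> //.
    by move: uj; rewrite !inE yuv.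
  move=> /potA; have [r ur ->] := Vex u pV; have [s vs ->] := Vex v pV.
  rewrite mul1r => rs; exists r, s; split=> //; apply/(omega_exprz_subE R k_gt0).
  by rewrite -[RHS]mulrC.
have [k_odd | k_even] := boolP (odd k); last first.
  have half := omega_exprz_half R k_gt0 k_even.
  have {}pV : partition_into V.
    apply: pV => u; have [n [m ->]] := val u.
    (* The sign [(-1) ^+ n] is absorbed as [w ^ (k./2 * n)]. *)
    exists (m - k./2%:Z * n%:Z).
    by rewrite opprB expfzDr // -exprz_exp half.
  have undV u v : undirected M u v -> exists j s : 'I_k,
      [/\ u \in V j, v \in V s & (s%:Z - j%:Z = k./2%:Z %[mod k%:Z])%Z].
    move=> /potU; have [j uj ->] := Vex u pV; have [s vs ->] := Vex v pV.
    by move=> js; exists j, s; split=> //; apply/(omega_exprz_subE R k_gt0); rewrite half.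
  have arcV u v : has_arc M u v -> exists j r : 'I_k,
      [/\ u \in V j, v \in V r & (r%:Z - j%:Z = k./2%:Z - 1 %[mod k%:Z])%Z].
    move=> /potA; have [j uj ->] := Vex u pV; have [r vr ->] := Vex v pV.
    move=> jr; exists j, r; split=> //; apply/(omega_exprz_subE R k_gt0).
    by apply: (mulIf w0); rewrite [LHS]jr expfzDr // half mulrAC divfK.
  exists V; split=> //; apply: Or32; split=> // j u v uj vj; apply/negP => uv.
  have yuv : y u = y v by rewrite (VE u j) // (VE v j).
  have yv0 : y v != 0 by rewrite (VE v j) // expfz_neq0.
  have N1 : 1 != -1 :> C by rewrite -subr_eq0 opprK -mulr2n pnatr_eq0.
  (* An arc inside one part would force [w = -1], and then [k] would divide 2, against [3 <= k]. *)
  have wN1 : w != -1.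
    apply/eqP=> wN1; have := prim_order_dvd (omega_primitive R k_gt0) 2.
    by rewrite wN1 eps2 eqxx => /dvdn_leq=> /(_ isT); rewrite leqNgt k_ge3.
  case: (edgeP uv) => [/potA|/potA|/potU + _].
  - by rewrite yuv mulrC => /(mulIf yv0)/eqP; apply/negP.
  - by rewrite yuv mulrC => /(mulIf yv0)/eqP; apply/negP.
  by rewrite yuv -[LHS]mul1r => /(mulIf yv0)/eqP; apply/negP.
(* Condition (iii) brings its own [2k] parts; the outer partition puts every vertex in part 0. *)
exists (fun j => [set _ | Ordinal k_gt0 == j]); split.
  apply: (@partition_into_fibers _ _ _ (fun=> Ordinal k_gt0) id) => // u.
  by exists (Ordinal k_gt0).
pose g (i : 'I_k + 'I_k) : C := match i with inl j => f j | inr j => - f j end.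
have g_inj : injective g.
  have fN i j : f i = - f j -> False.
    by apply/eqP; apply: omega_exprz_neqN.
  case=> i [] j /=; [by move/f_inj-> | by move/fN | | by move/oppr_inj/f_inj->].
  by move/esym/fN.
have pW : partition_into (fun i => [set u | y u == g i]).
  apply: partition_into_fibers => // u; have [n [m ->]] := val u.
  rewrite -signr_odd; have [j ->] := omega_expz_ord R k_gt0 m.
  case: (odd n); [exists (inr j) | exists (inl j)]; rewrite /= ?mul1r //.
  by rewrite mulN1r.
apply: Or33; split=> //.
pose W' j := [set u | y u == f j]; pose W'' j := [set u | y u == - f j].
exists W', W''; split.
- split; first by rewrite -pW.1; apply: eq_bigr => -[].
  by move=> i j /pW.2; case: i; case: j.
- move=> u v /potU; rewrite mulN1r => yuv.
  have [[j|j]] := partition_into_cover u pW; rewrite inE /= => /eqP yu; exists j.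
    by left; rewrite !inE -yu -[y v]opprK -yuv eqxx.
  by right; rewrite !inE yu -[y v]opprK -yuv yu opprK eqxx.
move=> u v /potA; rewrite mulN1r => yuv.
have fw r : f r * w = w ^ (1 - r%:Z) by rewrite addrC expfzDr.
have fN r s : f r * w = - f s -> False.
  by rewrite fw; apply/eqP; apply: omega_exprz_neqN.
have fS r s : f r * w = f s -> (r%:Z - s%:Z = 1 %[mod k%:Z])%Z.
  by move=> rs; apply/(omega_exprz_subE R k_gt0); rewrite -[LHS]rs mulrC.
(* An arc between labels of the same sign would equate a power of [w] with the negative of another,
   so only the mixed cases survive. *)
have [[r|r]] := partition_into_cover u pW; rewrite inE /= => /eqP yu;
  have [[s|s]] := partition_into_cover v pW; rewrite inE /= => /eqP yv;
  move: yuv; rewrite yu yv ?mulNr ?opprK.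
- by move/fN.
- by move/fS=> rs; exists r, s; split=> //; left; rewrite !inE yu yv.
- by move/oppr_inj/fS=> rs; exists r, s; split=> //; right; rewrite !inE yu yv.
by move/(canRL opprK)/fN.
Qed.

(** Without edges the equation is vacuous. This serves the case [Delta = 0], where [a / Delta] gives
    no unit [eps]. *)
Lemma potential_max_degree0 : Delta = 0%N -> potential 1 (fun=> 1).
Proof.
move=> D0 u v uv; suff : (0 < Delta)%N by rewrite D0.
by apply: leq_trans (degree_le_max u); apply/card_gt0P; exists v; rewrite inE.
Qed.

End Spectrum.

Theorem theorem4p1 (R : realType) (k : nat) (hk : (3 <= k)%N)
    (T : finType) (G : simple_graph T) (M : mixed_graph G)
    (hconn : connected_graph G) :
  (forall a : R[i], eigenvalue (hermitian_adj R k M) a ->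
     `|a| <= (max_degree G)%:R) /\
  (spectral_radius (hermitian_adj R k M) = (max_degree G)%:R <->
   regular_graph G (max_degree G) /\
   exists V : 'I_k -> {set T},
     partition_into V /\
     [\/ cond_i M V, cond_ii M V | cond_iii k M]).
Proof.
have k_gt0 : (0 < k)%N by apply: leq_trans hk.
split; first by move=> a; apply: eigenvalue_le_max_degree.
split=> [/(spectral_radius_hermitianP R M k_gt0) | [reg [V [pV condV]]]].
  have [D0 _ | D_gt0] := posnP (max_degree G).
    split; first by move=> u; apply/eqP; rewrite eqn_leq degree_le_max D0.
    apply: (potential_partition k_gt0 hk hconn _ _ (potential_max_degree0 R k M D0)).
      exact: expr1n.
    by move=> v; apply: oner_neq0.
  case=> [D0 | [a aH aD]]; first by rewrite D0 in D_gt0.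
  have [reg [eps [x [eps2 x0 pot]]]] := eigenvalue_potential k_gt0 hconn D_gt0 aH aD.
  by split=> //; apply: (potential_partition k_gt0 hk hconn eps2 x0 pot).
have [eps [x [eps2 x0 pot]]] := partition_potential R k_gt0 pV condV.
have /card_gt0P[v0 _] := hconn.1.
apply/(spectral_radius_hermitianP R M k_gt0); right; exists ((max_degree G)%:R * eps).
  exact: (regular_potential_eigenvalue reg (x0 v0) pot).
have neps : `|eps| = 1.
  by apply/eqP; rewrite -sqrp_eq1 // -normrX eps2 normr1.
by rewrite normrM normr_nat neps mulr1.
Qed.
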